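(* Let $\tilde A$ be an $n\times n$ real isotropic matrix all of whose eigenvalues are equal to $1$ in absolute value. Then there exist an orthogonal real $n\times n$ matrix $U$ and a symmetric positive definite real $n\times n$ matrix $Q$ such that $$\tilde A = Q U Q^{-1}.$$
   Context: A real square matrix is called isotropic if it is diagonalizable over $\mathbb{C}$ and all its (complex) eigenvalues are equal in absolute value. *)

(* Defs.v *)
From HB Require Import structures.
From mathcomp Require Import all_boot all_order all_algebra.
From mathcomp Require Import reals.
From mathcomp Require Import complex.

Set Implicit Arguments.
Unset Strict Implicit.
Unset Printing Implicit Defensive.

Import Order.TTheory GRing.Theory Num.Theory.
Local Open Scope ring_scope.
Local Open Scope complex_scope.

Definition complexmx (R : realType) (n : nat) (A : 'M[R]_n) : 'M[R[i]]_n :=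
  map_mx (real_complex R) A.

(* [eigenvalue] is defined by row eigenvectors; a square matrix has the same
   eigenvalues on rows and on columns. *)
Definition isotropic (R : realType) (n : nat) (A : 'M[R]_n) : Prop :=
  diagonalizable (complexmx A) /\
  forall a b : R[i], eigenvalue (complexmx A) a ->
    eigenvalue (complexmx A) b -> `|a| = `|b|.

(* [unitarymx] is only available over a [numClosedFieldType]. *)
Definition orthogonalmx (R : realType) (n : nat) (U : 'M[R]_n) : Prop :=
  U *m U^T = 1%:M.

Definition sym_posdefmx (R : realType) (n : nat) (Q : 'M[R]_n) : Prop :=
  Q \is symmetricmx /\
  forall x : 'cV[R]_n, x != 0 -> 0 < (x^T *m Q *m x) 0 0.

(* Main.v *)
Require Import Defs.
From mathcomp Require Import all_boot all_order all_algebra.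
From mathcomp Require Import reals complex.

(** If [A = V^-1 D V] with [D] diagonal and unimodular, then [A] preserves the
    positive definite hermitian form [M = V^-1 (V^-1)^*]: indeed [A M A^*] is
    [V^-1 D D^* (V^-1)^* = M].  Since [A] is real, it also preserves the
    conjugate of [M], hence the real form [P = M + conj M], which is symmetric
    and positive definite, with [A P A^T = P]
    ([real_invariant_form]).

    Let [Q] be a symmetric positive definite square root of [P].  In the
    coordinates given by [Q] the invariant form becomes the standard one, so
    [U = Q^-1 A Q] satisfies [U U^T = Q^-1 (A P A^T) Q^-1 = Q^-1 P Q^-1 = 1].

    The square root is obtained by taking square roots of the eigenvalues in a
    unitary diagonalization of [P] ([real_posdef_sqrt]).  That this complex
    matrix is real follows from its independence of the diagonalization
    ([unitary_diag_fun_uniq]): conjugating a diagonalization of the real matrix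
    [P] gives another diagonalization of [P].

    All of this takes place over an arbitrary numerically closed field, where
    real matrices are those with real entries; the result is then transported
    to matrices over the base field. *)

Import Order.TTheory GRing.Theory Num.Theory.
Local Open Scope ring_scope.
Local Open Scope complex_scope.

Lemma symmetricmxP {R : fieldType} {n : nat} {M : 'M[R]_n} :
  reflect (M^T = M) (M \is symmetricmx).
Proof.
by rewrite is_hermitianmxE expr0 scale1r map_mx_id // eq_sym; apply: eqP.
Qed.

(** * Positive definite matrices over a numerically closed field *)

Section ClosedField.
Import Num.Def.
Local Open Scope sesquilinear_scope.
Local Notation "M ^ phi" := (map_mx phi M) : ring_scope.
Context {C : numClosedFieldType} {n : nat}.
Implicit Types (A F M P Q S : 'M[C]_n) (d : 'rV[C]_n).

(** Row vectors are used because the orthonormal eigenvectors provided by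
    [spectralmx] are rows. *)
Definition posdefmx M :=
  forall x : 'rV[C]_n, x != 0 -> 0 < (x *m M *m x^t*) 0 0.

Lemma gram_trmxC F : (F *m F^t*)^t* = F *m F^t*.
Proof. by rewrite trmx_mul map_mxM trmxCK. Qed.

Lemma posdef_gram F : F \in unitmx -> posdefmx (F *m F^t*).
Proof.
move=> Fu x x0; have xF0 : x *m F != 0.
  by apply: contraNneq x0 => xF0; rewrite -(mulmxK Fu x) xF0 mul0mx.
have := dotmx_is_dotmx xF0.
by rewrite dotmxE trmx_mul map_mxM !mulmxA.
Qed.

Lemma posdefmxD M P : posdefmx M -> posdefmx P -> posdefmx (M + P).
Proof.
move=> Mpos Ppos x x0.
by rewrite mulmxDr mulmxDl mxE addr_gt0 ?Mpos ?Ppos.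
Qed.

(** Positivity excludes a nonzero vector in the kernel. *)
Lemma posdefmx_unit M : posdefmx M -> M \in unitmx.
Proof.
move=> Mpos; rewrite -row_free_unit -kermx_eq0; apply/negPn/negP.
move=> /rowV0Pn[x /sub_kermxP xM x0]; have := Mpos x x0.
by rewrite xM mul0mx mxE ltxx.
Qed.

(** * Functions of a matrix through a unitary diagonalization *)

Lemma unitary_diag_conj S d : (S^t* *m diag_mx d *m S) ^ conjC =
  (S ^ conjC)^t* *m diag_mx (d ^ conjC) *m S ^ conjC.
Proof. by rewrite !map_mxM map_diag_mx map_trmx. Qed.

(** If [W] intertwines two diagonal matrices, then [W i j] vanishes unless
    the [i]th and [j]th diagonal entries agree; so it also intertwines their
    images by [f]. *)
Lemma diag_fun_intertwine (f : C -> C) (W : 'M[C]_n) d d' :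
  W *m diag_mx d = diag_mx d' *m W ->
  W *m diag_mx (d ^ f) = diag_mx (d' ^ f) *m W.
Proof.
move=> /matrixP eqW; apply/matrixP=> i j; have := eqW i j.
rewrite !mul_mx_diag !mul_diag_mx !mxE mulrC.
have [-> _|W0] := eqVneq (W i j) 0; first by rewrite mulr0 mul0r.
by move/(mulIf W0) => ->; rewrite mulrC.
Qed.

(** The matrix [f (P)] of the functional calculus does not depend on the
    diagonalization of [P] that defines it. *)
Lemma unitary_diag_fun_uniq (f : C -> C) S S' d d' :
  S \is unitarymx -> S' \is unitarymx ->
  S^t* *m diag_mx d *m S = S'^t* *m diag_mx d' *m S' ->
  S^t* *m diag_mx (d ^ f) *m S = S'^t* *m diag_mx (d' ^ f) *m S'.
Proof.
move=> Su S'u eqP.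
have S'S'C : S' *m S'^t* = 1%:M by apply/unitarymxP.
have SCS : S^t* *m S = 1%:M by apply/mulmx1C/unitarymxP.
have S'CS' : S'^t* *m S' = 1%:M by apply/mulmx1C/unitarymxP.
have /diag_fun_intertwine -/(_ f) eqW :
    (S' *m S^t*) *m diag_mx d = diag_mx d' *m (S' *m S^t*).
  have := congr1 (fun X => S' *m X *m S^t*) eqP.
  by rewrite /= !mulmxA S'S'C mul1mx mulmxtVK // => ->; rewrite !mulmxA.
have := congr1 (fun X => S'^t* *m X *m S) eqW.
by rewrite /= !mulmxA S'CS' mul1mx -!mulmxA SCS mulmx1.
Qed.

Lemma real_posdef_sqrt P : P \is a realmx -> P \is symmetricmx ->
    posdefmx P ->
  exists Q, [/\ Q \is a realmx, Q \is symmetricmx, posdefmx Q & Q *m Q = P].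
Proof.
move=> Preal Psym Ppos; pose S := spectralmx P; pose d := spectral_diag P.
have Su : S \is unitarymx := spectral_unitarymx P.
have SSC : S *m S^t* = 1%:M by apply/unitarymxP.
have PE : P = S^t* *m diag_mx d *m S.
  rewrite -invmx_unitary //; apply/orthomx_spectralP.
  exact: symmetric_normalmx.
(* The eigenvalue is the value of the form at its unit eigenvector. *)
have d_gt0 i : 0 < d 0 i.
  have rS0 : row i S != 0.
    apply/eqP => rS0; have /unitarymxP/(congr1 (row i)) := Su.
    rewrite row_mul rS0 mul0mx row1 => /rowP/(_ i).
    by rewrite !mxE !eqxx => /esym/eqP; rewrite oner_eq0.
  have := Ppos _ rS0; suff -> : row i S *m P *m (row i S)^t* = (d 0 i)%:M.
    by rewrite mxE eqxx.
  rewrite PE !mulmxA -row_mul SSC row1 -mulmxA -mulmxA.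
  have -> : S *m (row i S)^t* = (delta_mx 0 i)^T.
    rewrite tr_row map_col colE mulmxA SSC mul1mx.
    by apply/matrixP=> j k; rewrite !mxE andbC.
  apply/matrixP=> j k; rewrite !ord1 mul_diag_mx -rowE !mxE !eqxx /=.
  by rewrite mulr1.
pose Q := S^t* *m diag_mx (d ^ sqrtC) *m S.
(* Splitting each root into its own square roots exhibits [Q] as a Gram
   matrix, hence as hermitian and positive definite. *)
pose F := S^t* *m diag_mx ((d ^ sqrtC) ^ sqrtC).
have QE : Q = F *m F^t*.
  rewrite /F trmx_mul map_mxM trmxCK tr_diag_mx map_diag_mx !mulmxA.
  rewrite -(mulmxA (S^t*)) mulmx_diag /Q; congr (_ *m diag_mx _ *m _).
  apply/rowP=> i; rewrite !mxE /= (CrealP _) ?ger0_real ?sqrtC_ge0 ?ltW //.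
  by rewrite -expr2 sqrtCK.
have Fu : F \in unitmx.
  rewrite unitmx_mul unitarymx_unit ?trmxC_unitary //= unitmxE unitfE det_diag.
  by apply/prodf_neq0=> i _; rewrite !mxE !sqrtC_eq0 gt_eqF.
(* Conjugating the diagonalization of [P] gives a second one, with the same
   eigenvalues; [conj Q] is the root that it defines. *)
have Qreal : Q ^ conjC = Q.
  have -> : Q ^ conjC = (S ^ conjC)^t* *m diag_mx (d ^ sqrtC) *m S ^ conjC.
    rewrite unitary_diag_conj; congr (_ *m diag_mx _ *m _); apply/rowP=> i.
    by rewrite !mxE /= (CrealP _) ?ger0_real ?sqrtC_ge0 ?ltW.
  apply: unitary_diag_fun_uniq; rewrite ?conjC_unitary //.
  rewrite -PE -[RHS](realmxC Preal) PE unitary_diag_conj.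
  congr (_ *m diag_mx _ *m _); apply/rowP=> i.
  by rewrite !mxE /= (CrealP _) ?ger0_real ?ltW.
exists Q; split.
- apply/mxOverP=> i j; apply/CrealP.
  by have /matrixP/(_ i j) := Qreal; rewrite mxE.
- by apply/symmetricmxP; rewrite -[in LHS]Qreal map_trmx QE gram_trmxC.
- by rewrite QE; exact: posdef_gram.
- rewrite /Q !mulmxA mulmxtVK // -(mulmxA (S^t*)) mulmx_diag PE.
  by congr (_ *m diag_mx _ *m _); apply/rowP=> i; rewrite !mxE -expr2 sqrtCK.
Qed.

(** * The invariant form *)

(** The hermitian form making an eigenbasis orthonormal is invariant, because
    the eigenvalues are unimodular; adding its conjugate makes it real without
    losing positivity. *)
Lemma real_invariant_form A : A \is a realmx -> diagonalizable A ->
    (forall a, eigenvalue A a -> `|a| = 1) ->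
  exists P, [/\ P \is a realmx, P \is symmetricmx, posdefmx P &
    A *m P *m A^T = P].
Proof.
move=> Areal [V Vu /diagonalizable_forPex[d /(simmxP Vu) VA]] eig1.
have d1 i : `|d 0 i| = 1.
  apply/eig1/eigenvalueP; exists (row i V).
    by rewrite -row_mul VA; apply/rowP=> j; rewrite mul_diag_mx !mxE.
  apply: contraTneq Vu => rV0; rewrite -row_free_unit.
  by apply/row_freePn; exists i; rewrite rV0 sub0mx.
pose W := invmx V; pose M := W *m W^t*.
have AW : A *m W = W *m diag_mx d.
  by rewrite -[A in LHS](mulKmx Vu) VA !mulmxA mulmxK.
have AC : A ^ conjC = A by exact: realmxC.
have AM : A *m M *m A^T = M.
  rewrite -{2}AC map_trmx mulmxA AW -mulmxA -map_mxM -trmx_mul AW.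
  rewrite trmx_mul map_mxM tr_diag_mx map_diag_mx !mulmxA.
  rewrite -(mulmxA W) mulmx_diag /M -[X in _ = X *m _](mulmx1 W).
  rewrite -diag_const_mx.
  congr (_ *m diag_mx _ *m _); apply/rowP=> i.
  by rewrite !mxE -normCK d1 expr1n.
have MC : M ^t* = M := gram_trmxC W.
exists (M + M ^ conjC); split.
- apply/mxOverP=> i j; rewrite mxE [X in _ + X]mxE; apply/CrealP.
  by rewrite rmorphD /= conjCK addrC.
- have MT : M^T = M ^ conjC by rewrite -[in RHS]MC map_mxCK.
  by apply/symmetricmxP; rewrite raddfD /= map_trmx MT map_mxCK addrC.
- have Wu : W \in unitmx by rewrite unitmx_inv.
  apply: posdefmxD; first exact: posdef_gram.
  have -> : M ^ conjC = W ^ conjC *m (W ^ conjC)^t*.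
    by rewrite map_mxM map_trmx.
  by apply: posdef_gram; rewrite map_unitmx.
- rewrite mulmxDr mulmxDl AM; congr (_ + _).
  by rewrite -[in RHS]AM (map_mxM _ (A *m M)) (map_mxM _ A) -map_trmx AC.
Qed.

End ClosedField.

(** * Descent to the base field *)

Lemma realmx_complexmx {R : realType} {n : nat} (Q : 'M[R[i]]_n) :
  Q \is a realmx -> exists Q' : 'M[R]_n, Q = complexmx Q'.
Proof.
move=> /mxOverP Qreal; exists (map_mx (@complex.Re R) Q).
by apply/matrixP=> i j; rewrite !mxE RRe_real.
Qed.

Lemma sym_posdefmx_complexmx {R : realType} {n : nat} (Q : 'M[R]_n) :
  complexmx Q \is symmetricmx -> posdefmx (complexmx Q) -> sym_posdefmx Q.
Proof.
move=> /symmetricmxP Qsym Qpos; split.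
  apply/symmetricmxP/(@map_mx_inj _ _ (real_complex R)).
  by rewrite -map_trmx.
move=> x x0; rewrite -ltcR.
have xC0 : map_mx (real_complex R) x^T != 0.
  by rewrite map_mx_eq0 trmx_eq0.
have := Qpos _ xC0; rewrite realmxC.
  by rewrite /complexmx map_trmx trmxK -!map_mxM mxE.
by apply/mxOverP=> i j; rewrite !mxE complex_real.
Qed.

Theorem theorem2p1 (R : realType) (n : nat) (A : 'M[R]_n)
    (A_isotropic : isotropic A)
    (A_eig1 : forall a : R[i], eigenvalue (complexmx A) a -> `|a| = 1) :
  exists U Q : 'M[R]_n,
    [/\ orthogonalmx U, sym_posdefmx Q & A = Q *m U *m invmx Q].
Proof.
have [Adiag _] := A_isotropic.
have Areal : complexmx A \is a realmx.
  by apply/mxOverP=> i j; rewrite mxE complex_real.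
have [P [Preal Psym Ppos APA]] := real_invariant_form _ Areal Adiag A_eig1.
have [QC [QCreal QCsym QCpos QCE]] := real_posdef_sqrt _ Preal Psym Ppos.
have [Q QE] := realmx_complexmx _ QCreal; subst QC.
have Qspd := sym_posdefmx_complexmx _ QCsym QCpos.
have Qu : Q \in unitmx by have := posdefmx_unit _ QCpos; rewrite map_unitmx.
have QT : Q^T = Q by have [/symmetricmxP] := Qspd.
have AQA : A *m (Q *m Q) *m A^T = Q *m Q.
  apply: (@map_mx_inj _ _ (real_complex R)).
  by rewrite !map_mxM -map_trmx QCE.
exists (invmx Q *m A *m Q), Q; split => //.
- rewrite /orthogonalmx !trmx_mul trmx_inv QT !mulmxA.
  have -> : invmx Q *m A *m Q *m Q *m A^T = invmx Q *m (A *m (Q *m Q) *m A^T).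
    by rewrite !mulmxA.
  by rewrite AQA mulKmx // mulmxV.
- by rewrite !mulmxA mulmxV // mul1mx mulmxK.
Qed.
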